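(* The matrices $\mathsf{F}(q)=(f_{n,k}(q))_{n,k\ge 0}$ and $\mathsf{T}(q)=(t_{n,k}(q))_{n,k\ge 0}$ with entries in the polynomial ring $\mathbb{Z}[q]$ are coefficientwise totally positive, i.e. every minor of each of these matrices is a polynomial in $q$ with nonnegative coefficients.
   Context: Here $[n]_q=1+q+\cdots+q^{n-1}$ for $n>0$, $[0]_q=0$, $[n]_q!=\prod_{j=1}^n[j]_q$ (with $[0]_q!=1$), and $\binom{n}{k}_q=\frac{[n]_q!}{[k]_q!\,[n-k]_q!}$ for $0\le k\le n$, and $0$ otherwise. The $q$-forests matrix $\mathsf{F}(q)$ has entries $f_{n,k}(q)=\delta_{nk}$ if $k=0$; $f_{n,k}(q)=\binom{n-1}{k-1}_q([n]_q)^{n-k}$ if $n\ge k\ge 1$; and $f_{n,k}(q)=0$ otherwise. The $q$-trees matrix $\mathsf{T}(q)$ has entries $t_{n,k}(q)=\binom{n}{k}_q([n]_q)^{n-k}$ for $n\ge k\ge 0$ and $0$ for $k>n$; in particular $t_{0,0}(q)=1$. A minor is the determinant of a finite square submatrix formed from any increasing choice of rows and any increasing choice of the same number of columns. *)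

(* Defs.v *)
From HB Require Import structures.
From mathcomp Require Import all_boot all_order all_algebra ring.

Set Implicit Arguments.
Unset Strict Implicit.
Unset Printing Implicit Defensive.

Import Order.TTheory GRing.Theory Num.Theory.

Local Open Scope ring_scope.

Definition qint (n : nat) : {poly int} := \sum_(i < n) 'X^i.

Definition qfact (n : nat) : {poly int} := \prod_(1 <= j < n.+1) qint j.

(* [%/] on {poly int} is pseudo-division, but it is the Euclidean division here
   because q-factorials are monic; the quotient is exact by [qbinomP]. *)
Definition qbinom (n k : nat) : {poly int} :=
  if (k <= n)%N then qfact n %/ (qfact k * qfact (n - k)) else 0.

Definition qforests (n k : nat) : {poly int} :=
  if k == 0%N then (n == k)%:R
  else if (k <= n)%N then qbinom n.-1 k.-1 * qint n ^+ (n - k)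
  else 0.

Definition qtrees (n k : nat) : {poly int} :=
  if (k <= n)%N then qbinom n k * qint n ^+ (n - k) else 0.

Definition minor_mx (R : Type) (M : nat -> nat -> R) (r : nat)
    (rows cols : 'I_r -> nat) : 'M[R]_r :=
  \matrix_(a, b) M (rows a) (cols b).

Definition increasing (r : nat) (f : 'I_r -> nat) : Prop :=
  forall a b : 'I_r, (a < b)%N -> (f a < f b)%N.

Definition coefficientwise_nonneg (p : {poly int}) : Prop :=
  forall m : nat, 0 <= p`_m.

Definition coefficientwise_TP (M : nat -> nat -> {poly int}) : Prop :=
  forall (r : nat) (rows cols : 'I_r -> nat),
    increasing rows -> increasing cols ->
    coefficientwise_nonneg (\det (minor_mx M rows cols)).

Lemma qintD (m n : nat) : qint (m + n) = qint m + 'X^m * qint n.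
Proof.
rewrite /qint big_split_ord /= mulr_sumr; congr (_ + _).
by apply: eq_bigr => i _; rewrite exprD.
Qed.

Lemma qint_monic (n : nat) : qint n.+1 \is monic.
Proof.
elim: n => [|n IHn]; first by rewrite /qint big_ord1 expr0 monic1.
rewrite -addn1 qintD /qint big_ord1 expr0 mulr1 addrC.
rewrite monicE lead_coefDl ?lead_coefXn // size_polyXn ltnS.
apply: (leq_trans (size_sum _ _ _)); apply/bigmax_leqP => i _.
by rewrite size_polyXn.
Qed.

Lemma qfactS (n : nat) : qfact n.+1 = qfact n * qint n.+1.
Proof. by rewrite /qfact big_nat_recr. Qed.

Lemma qfact0 : qfact 0 = 1.
Proof. by rewrite /qfact big_geq. Qed.

Lemma qfact_monic (n : nat) : qfact n \is monic.
Proof.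
elim: n => [|n IHn]; first by rewrite qfact0 monic1.
by rewrite qfactS monicMl // qint_monic.
Qed.

Lemma qfact_dvd (m n : nat) :
  exists p : {poly int}, qfact (m + n) = p * (qfact m * qfact n).
Proof.
have [s] := ubnP (m + n); elim: s m n => // s IHs [|m] [|n] lt_s.
- by exists 1; rewrite qfact0 !mul1r.
- by exists 1; rewrite qfact0 !mul1r.
- by exists 1; rewrite qfact0 addn0 mul1r mulr1.
have [p Dp] : exists p, qfact (m + n.+1) = p * (qfact m * qfact n.+1).
  by apply: IHs; rewrite addSn in lt_s.
have [p' Dp'] : exists p, qfact (m.+1 + n) = p * (qfact m.+1 * qfact n).
  by apply: IHs; rewrite addnS in lt_s.
exists (p + p' * 'X^(m.+1)).
have -> : qfact (m.+1 + n.+1) = qfact (m + n.+1) * qint (m.+1 + n.+1).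
  by rewrite addSn qfactS.
rewrite qintD mulrDr Dp.
rewrite mulrDl; congr (_ + _).
  by rewrite (qfactS m); ring.
have -> : p * (qfact m * qfact n.+1) = p' * (qfact m.+1 * qfact n).
  by rewrite -Dp -Dp' addSnnS.
by rewrite (qfactS n); ring.
Qed.

Lemma qbinomP (n k : nat) :
  (k <= n)%N -> qbinom n k * (qfact k * qfact (n - k)) = qfact n.
Proof.
move=> le_kn; rewrite /qbinom le_kn.
have [p] := qfact_dvd k (n - k); rewrite subnKC // => ->.
by rewrite Pdiv.IdomainMonic.mulpK // monicMl qfact_monic.
Qed.

(* Main.v *)
Require Import Defs.
From mathcomp Require Import all_boot all_order all_algebra.
From mathcomp Require Import zify ring.

Set Implicit Arguments.
Unset Strict Implicit.
Unset Printing Implicit Defensive.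

Import Order.TTheory GRing.Theory Num.Theory.

Local Open Scope ring_scope.

(** The two matrices are the first members of one family of q-Abel matrices:
    for s >= 0 let A_s be the unit lower triangular matrix with entries
      A_s(n, k) = binom(n, k)_q * [n+s]_q ^ (n-k)      ([qabel]).
    Then T(q) = A_0, and F(q) = 1 (+) A_1 is A_1 bordered by a corner entry 1
    ([one_oplus]).  Consecutive members of the family are related by a
    factorization ([qabel_rec])
      A_s * (I - C_s) = (1 (+) A_(s+1)) * (I + B_s),
    in which B_s and C_s live on the subdiagonal, with the coefficientwise
    nonnegative entries
      B_s(k+1, k) = q^k [s]_q      and      C_s(k+1, k) = q^(k+s) [k+1]_q.
    Hence A_s is obtained from 1 (+) A_(s+1) by multiplying on the right by
    the bidiagonal matrix I + B_s and by the inverse of the bidiagonal matrix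
    I - C_s.  Restricted to finitely many rows, each of these is a composite of
    column operations that add a nonnegative multiple of a column to the column
    on its left.  Such an operation preserves total positivity ([TP_add_col]),
    and so does bordering ([TP_one_oplus]).

    Bordering consumes one row: the rows below N of A_s only involve the rows
    below N - 1 of A_(s+1).  So total positivity of the rows below N follows by
    induction on N, for all s at once ([TP_qabel]).

    To find the factorization, put y = [n+s]_q.  Up to factors that depend on
    the column only, A_s(n, k) is
      y^(n-k) * prod_(s <= i < k+s) (y - [i]_q),
    so that, after division by y^n, the columns are Newton polynomials in 1/y
    with nodes 1/[i]_q.  Passing from s+1 to s multiplies these polynomials by
    y - [s]_q.  Iterating 1/x = [k]_q + (1 - [k]_q x) / x shows that
    multiplication by y takes the Newton polynomial with last node 1/[k-1]_q to
    [k]_q times itself, plus [k+1]_q times the next one, and so on; this operator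
    is a diagonal matrix times the inverse of I minus the shift, so that
    subtracting [s]_q turns it into a bidiagonal matrix times that same
    inverse. *)

(** * Coefficientwise nonnegative polynomials *)

Lemma nonnegD p q :
  coefficientwise_nonneg p -> coefficientwise_nonneg q ->
  coefficientwise_nonneg (p + q).
Proof. by move=> p0 q0 m; rewrite coefD addr_ge0. Qed.

Lemma nonnegM p q :
  coefficientwise_nonneg p -> coefficientwise_nonneg q ->
  coefficientwise_nonneg (p * q).
Proof. by move=> p0 q0 m; rewrite coefM sumr_ge0 // => i _; rewrite mulr_ge0. Qed.

Lemma nonneg1 : coefficientwise_nonneg 1.
Proof. by move=> m; rewrite coef1; case: (m == 0%N). Qed.

Lemma nonneg0 : coefficientwise_nonneg 0.
Proof. by move=> m; rewrite coef0. Qed.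

Lemma nonnegXn n : coefficientwise_nonneg 'X^n.
Proof. by move=> m; rewrite coefXn; case: (m == n). Qed.

Lemma nonneg_qint n : coefficientwise_nonneg (qint n).
Proof. by move=> m; rewrite coef_sum sumr_ge0 // => i _; apply: nonnegXn. Qed.

(** * Total positivity of the first rows of a matrix *)

(** Bounding the rows serves two ends: the induction runs on the bound, and a
    lower triangular matrix has only finitely many nonzero columns within it. *)
Definition TP_upto (N : nat) (M : nat -> nat -> {poly int}) : Prop :=
  forall (r : nat) (rows cols : 'I_r -> nat),
    increasing rows -> increasing cols -> (forall a, (rows a < N)%N) ->
    coefficientwise_nonneg (\det (minor_mx M rows cols)).

Lemma TP_upto0 M : TP_upto 0 M.
Proof.
move=> [|r] rows cols _ _ lt0; last by have := lt0 ord0.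
by rewrite det_mx00; apply: nonneg1.
Qed.

Lemma TP_uptoP M : (forall N, TP_upto N M) -> coefficientwise_TP M.
Proof.
move=> TP_M r rows cols inc_rows inc_cols.
apply: (TP_M (\max_a rows a).+1) => // a.
by rewrite ltnS (leq_bigmax a).
Qed.

Lemma eq_TP_upto N M M' :
  (forall n k, (n < N)%N -> M n k = M' n k) -> TP_upto N M -> TP_upto N M'.
Proof.
move=> eqM TP_M r rows cols inc_rows inc_cols ltN.
have -> : minor_mx M' rows cols = minor_mx M rows cols.
  by apply/matrixP => a b; rewrite !mxE eqM.
exact: TP_M.
Qed.

Lemma increasing_neq r (f : 'I_r -> nat) (b : 'I_r) (j : 'I_r.-1) :
  increasing f -> f (lift b j) != f b.
Proof.
move=> inc_f; have := inc_f (lift b j) b; have := inc_f b (lift b j).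
have := neq_lift b j; rewrite -val_eqE /=; lia.
Qed.

(** In a minor that uses column [m], the determinant is additive in that column:
    the new term is [c] times the minor in which [m] is replaced by [m.+1].  That
    minor either repeats a column, hence vanishes, or its columns are still
    increasing, because no index lies strictly between [m] and [m.+1]. *)
Lemma TP_add_col N M m c :
    coefficientwise_nonneg c -> TP_upto N M ->
  TP_upto N (fun n k => M n k + (if k == m then c * M n k.+1 else 0)).
Proof.
move=> c_ge0 TP_M r rows cols inc_rows inc_cols ltN.
set M' := fun n k => _.
case: (pickP (fun b => cols b == m)) => [b /eqP cols_b | no_m]; last first.
  have -> : minor_mx M' rows cols = minor_mx M rows cols.
    by apply/matrixP => i j; rewrite !mxE /M' no_m addr0.
  exact: TP_M.
pose cols' j := if j == b then m.+1 else cols j.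
have -> : \det (minor_mx M' rows cols)
    = 1 * \det (minor_mx M rows cols) + c * \det (minor_mx M rows cols').
  rewrite -!(det_tr (minor_mx _ _ _)); apply: (determinant_multilinear (i0 := b)).
  - by apply/rowP => i; rewrite !mxE /M' /cols' cols_b !eqxx mul1r.
  - apply/matrixP => j i; rewrite !mxE /M' -cols_b.
    by rewrite (negPf (increasing_neq _ _ _)) // addr0.
  - apply/matrixP => j i; rewrite !mxE /M' /cols' -cols_b.
    by rewrite eq_sym (negPf (neq_lift _ _)) (negPf (increasing_neq _ _ _)) // addr0.
rewrite mul1r; apply: nonnegD; first exact: TP_M.
apply: nonnegM => //.
case: (pickP (fun j => cols j == m.+1)) => [j /eqP cols_j | no_m1].
  have neq_jb : j != b by apply/eqP => eq_jb; move: cols_j; rewrite eq_jb; lia.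
  rewrite -det_tr (determinant_alternate neq_jb); first exact: nonneg0.
  by move=> i; rewrite !mxE /cols' eqxx (negPf neq_jb) cols_j.
apply: TP_M => // i j lt_ij; rewrite /cols'.
have := inc_cols _ _ lt_ij; have /eqP := no_m1 j.
case: eqP => [eq_ib|_]; case: eqP => [eq_jb|_]; subst; lia.
Qed.

(** Multiplication by I + B with B on the subdiagonal.  The columns are treated
    from left to right, so that each one receives its still unmodified right
    neighbour. *)
Lemma TP_bidiagonal N M (b : nat -> {poly int}) :
    (forall k, coefficientwise_nonneg (b k)) -> TP_upto N M ->
  TP_upto N (fun n k => M n k + b k * M n k.+1).
Proof.
move=> b_ge0 TP_M.
pose K m n k := M n k + (if (k < m)%N then b k * M n k.+1 else 0).
have TP_K m : TP_upto N (K m).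
  elim: m => [|m IHm].
    by apply: eq_TP_upto TP_M => n k _; rewrite /K ltn0 addr0.
  apply: eq_TP_upto (TP_add_col m (b_ge0 m) IHm) => n k _; rewrite /K ltnS.
  case: ltngtP => [||->]; rewrite ?addr0 ?ltnNge ?leqnSn //=.
  by rewrite addr0.
move=> r rows cols inc_rows inc_cols ltN.
have -> : minor_mx (fun n k => M n k + b k * M n k.+1) rows cols
    = minor_mx (K (\max_a cols a).+1) rows cols.
  by apply/matrixP => i j; rewrite !mxE /K ltnS (leq_bigmax j).
exact: TP_K.
Qed.

(** Multiplication by the inverse of I - C with C on the subdiagonal: column [k]
    of the product [H] is column [k] of [M] plus [c k] times column [k.+1] of [H].
    The columns are treated from right to left, so that each one receives its
    already final right neighbour; triangularity of [H] makes the process start,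
    as within the first [N] rows the columns of index at least [N] are zero. *)
Lemma TP_bidiagonal_inv N M H (c : nat -> {poly int}) :
    (forall k, coefficientwise_nonneg (c k)) ->
    (forall n k, (n < k)%N -> H n k = 0) ->
    (forall n k, H n k = M n k + c k * H n k.+1) ->
  TP_upto N M -> TP_upto N H.
Proof.
move=> c_ge0 H_low HE TP_M.
pose K m n k := if (k < m)%N then M n k else H n k.
suff TP_K d : (d <= N)%N -> TP_upto N (K (N - d)%N).
  by have := TP_K N (leqnn N); rewrite subnn; apply: eq_TP_upto.
elim: d => [_ | d IHd lt_dN].
  rewrite subn0; apply: eq_TP_upto TP_M => n k lt_nN; rewrite /K.
  case: ltnP => // le_Nk.
  by rewrite HE [H n k.+1]H_low ?mulr0 ?addr0 //; lia.
set m := (N - d.+1)%N; have Dm : (N - d)%N = m.+1 by lia.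
have := IHd (ltnW lt_dN); rewrite Dm => TP_Km.
apply: eq_TP_upto (TP_add_col m (c_ge0 m) TP_Km) => n k _.
rewrite /K (ltnS k m); case: (ltngtP k m) => [_|_|->]; rewrite ?addr0 //.
by rewrite ltnn -HE.
Qed.

(** * Bordering by a corner entry 1 *)

Definition one_oplus (M : nat -> nat -> {poly int}) (n k : nat) : {poly int} :=
  match n, k with
  | 0, 0 => 1
  | n'.+1, k'.+1 => M n' k'
  | _, _ => 0
  end.

Lemma increasing_gt0 r (f : 'I_r.+1 -> nat) :
  increasing f -> (0 < f ord0)%N -> forall i, (0 < f i)%N.
Proof.
move=> inc_f f0 i; have [i0|/(inc_f ord0 i)] := posnP i; last lia.
by have -> : i = ord0 by apply: val_inj.
Qed.

Lemma one_oplus_predn M n k :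
  (0 < n)%N -> (0 < k)%N -> one_oplus M n k = M n.-1 k.-1.
Proof. by case: n k => [|n] [|k]. Qed.

(** Since the rows and columns increase, only the first of each can be the new
    one.  If both are, expansion along that row leaves a minor of [M]; if exactly
    one is, the minor has a zero row or column; otherwise it is a minor of [M]. *)
Lemma TP_one_oplus N M : TP_upto N M -> TP_upto N.+1 (one_oplus M).
Proof.
move=> TP_M [|r] rows cols inc_rows inc_cols ltN.
  by rewrite det_mx00; apply: nonneg1.
have [rows0|rows_gt0] := posnP (rows ord0);
  have [cols0|cols_gt0] := posnP (cols ord0).
- have rows_gt0 i : (0 < rows (lift ord0 i))%N.
    by have := inc_rows ord0 (lift ord0 i) isT; lia.
  have cols_gt0 i : (0 < cols (lift ord0 i))%N.
    by have := inc_cols ord0 (lift ord0 i) isT; lia.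
  rewrite (expand_det_row _ ord0) big_ord_recl big1 => [|j _]; last first.
    by rewrite mxE rows0; case: (cols _) (cols_gt0 j) => // k _; rewrite mul0r.
  rewrite addr0 mxE rows0 cols0 mul1r /cofactor expr0 mul1r.
  have -> : row' ord0 (col' ord0 (minor_mx (one_oplus M) rows cols))
      = minor_mx M (fun i => (rows (lift ord0 i)).-1)
                   (fun i => (cols (lift ord0 i)).-1).
    by apply/matrixP => i j; rewrite !mxE one_oplus_predn.
  apply: TP_M => [i j lt_ij|i j lt_ij|i].
  + have /inc_rows : (lift ord0 i < lift ord0 j)%N by [].
    by have := rows_gt0 i; lia.
  + have /inc_cols : (lift ord0 i < lift ord0 j)%N by [].
    by have := cols_gt0 i; lia.
  + by have := ltN (lift ord0 i); have := rows_gt0 i; lia.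
- rewrite (expand_det_row _ ord0) big1 => [|j _]; first exact: nonneg0.
  rewrite mxE rows0; have := increasing_gt0 inc_cols cols_gt0 j.
  by case: (cols j) => // k _; rewrite mul0r.
- rewrite (expand_det_col _ ord0) big1 => [|i _]; first exact: nonneg0.
  rewrite mxE cols0; have := increasing_gt0 inc_rows rows_gt0 i.
  by case: (rows i) => // n _; rewrite mul0r.
have {}rows_gt0 := increasing_gt0 inc_rows rows_gt0.
have {}cols_gt0 := increasing_gt0 inc_cols cols_gt0.
have -> : minor_mx (one_oplus M) rows cols
    = minor_mx M (fun i => (rows i).-1) (fun i => (cols i).-1).
  by apply/matrixP => i j; rewrite !mxE one_oplus_predn.
apply: TP_M => [i j /inc_rows|i j /inc_cols|i].
- by have := rows_gt0 i; lia.
- by have := cols_gt0 i; lia.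
- by have := ltN i; have := rows_gt0 i; lia.
Qed.

(** * Identities for q-binomial coefficients *)

Lemma qfact_neq0 n : qfact n != 0.
Proof. exact/monic_neq0/qfact_monic. Qed.

Lemma qint_neq0 n : qint n.+1 != 0.
Proof. exact/monic_neq0/qint_monic. Qed.

Lemma qbinom_small n k : (n < k)%N -> qbinom n k = 0.
Proof. by move=> lt_nk; rewrite /qbinom leqNgt lt_nk. Qed.

Lemma qbinom0 n : qbinom n 0 = 1.
Proof.
apply: (mulIf (qfact_neq0 n)); rewrite mul1r.
by have := qbinomP (leq0n n); rewrite qfact0 mul1r subn0.
Qed.

Lemma qbinomnn n : qbinom n n = 1.
Proof.
apply: (mulIf (qfact_neq0 n)); rewrite mul1r.
by have := qbinomP (leqnn n); rewrite subnn qfact0 mulr1.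
Qed.

Lemma mul_qbinom_diag n k :
  qint n.+1 * qbinom n k = qint k.+1 * qbinom n.+1 k.+1.
Proof.
have [lt_nk|le_kn] := ltnP n k.
  by rewrite !qbinom_small ?mulr0.
have nz : qfact k * qfact (n - k) != 0 by rewrite mulf_neq0 ?qfact_neq0.
apply: (mulIf nz); rewrite -mulrA qbinomP //.
have := @qbinomP n.+1 k.+1 le_kn; rewrite subSS !qfactS => E.
by rewrite mulrC -E; ring.
Qed.

Lemma mul_qbinom_left n k :
  qint k.+1 * qbinom n k.+1 = qint (n - k) * qbinom n k.
Proof.
have [le_nk|lt_kn] := leqP n k.
  have -> : (n - k)%N = 0%N by lia.
  by rewrite qbinom_small // mulr0 /qint big_ord0 mul0r.
have nz : qfact k * qfact (n - k.+1) != 0 by rewrite mulf_neq0 ?qfact_neq0.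
apply: (mulIf nz).
have := qbinomP lt_kn; rewrite -(qbinomP (ltnW lt_kn)).
have -> : (n - k)%N = (n - k.+1).+1 by lia.
rewrite !qfactS => E.
by transitivity (qbinom n k.+1 * (qfact k * qint k.+1 * qfact (n - k.+1)));
  [ring | rewrite E; ring].
Qed.

(** After q^j = 1 + (q-1)[j] is substituted, both sides are the same polynomial in
    q, [k], [m] and [s]. *)
Lemma qintM_shift k m s :
  qint (k + m) * qint (k + s)
    = qint k * qint (k + m + s) + 'X^k * qint s * qint m.
Proof.
have E : 'X^(k + m) = 1 + ('X - 1) * qint (k + m) :> {poly int}.
  by rewrite /qint -subrX1 addrC subrK.
have Ek : 'X^k = 1 + ('X - 1) * qint k :> {poly int}.
  by rewrite /qint -subrX1 addrC subrK.
rewrite (qintD (k + m)) E (qintD k s) (qintD k m) Ek; ring.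
Qed.

(** For [s] = 0 this is [mul_qbinom_diag], and as [s] grows it tends to the Pascal
    rule.  Multiplied by [k+1]_q, it is binom(n, k)_q times an instance of
    [qintM_shift]. *)
Lemma qbinom_shift n k s :
  qbinom n.+1 k.+1 * qint (k.+1 + s)
    = qbinom n k * qint (n.+1 + s) + 'X^(k.+1) * qint s * qbinom n k.+1.
Proof.
have [lt_nk|le_kn] := ltnP n k.
  by rewrite !qbinom_small ?mul0r ?mulr0 ?addr0 //; lia.
apply: (mulfI (qint_neq0 k)).
have D := mul_qbinom_diag n k; have L := mul_qbinom_left n k.
rewrite mulrA -D mulrDr.
have -> : qint k.+1 * ('X^(k.+1) * qint s * qbinom n k.+1)
    = 'X^(k.+1) * qint s * (qint k.+1 * qbinom n k.+1) by ring.
rewrite L.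
have := qintM_shift k.+1 (n - k) s.
have -> : (k.+1 + (n - k))%N = n.+1 by lia.
move=> E.
transitivity (qbinom n k * (qint n.+1 * qint (k.+1 + s))); first ring.
by rewrite E; ring.
Qed.

(** * The family of q-Abel matrices *)

Definition qabel (s n k : nat) : {poly int} :=
  qbinom n k * qint (n + s) ^+ (n - k).

(** The factorization A_s * (I - C_s) = (1 (+) A_(s+1)) * (I + B_s), entry by
    entry.  For row n and column 0 < k < n the term of C_s reduces, by
    [mul_qbinom_left] and [n+s] = [k+s] + q^(k+s) [n-k], the left side to
    binom(n, k)_q [k+s] [n+s]^(n-k-1), which [qbinom_shift] splits into the two
    terms on the right.  Row n of A_s and row n-1 of A_(s+1) carry the same base
    [n+s], which is what makes them comparable. *)
Lemma qabel_rec s n k :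
  qabel s n k
    = (one_oplus (qabel s.+1) n k
       + 'X^k * qint s * one_oplus (qabel s.+1) n k.+1)
      + 'X^(k + s) * qint k.+1 * qabel s n k.+1.
Proof.
case: n => [|n]; first case: k => [|k].
- rewrite /qabel /= qbinom0 [qbinom 0 1]qbinom_small //; ring.
- rewrite /qabel /= !qbinom_small //; ring.
have [lt_nk|le_kn] := ltnP n.+1 k.
  rewrite /qabel [qbinom n.+1 _]qbinom_small //.
  rewrite [qbinom n.+1 _]qbinom_small; last by lia.
  case: k lt_nk => // k lt_nk /=.
  rewrite /= !qbinom_small; [ring | lia | lia].
rewrite leq_eqVlt in le_kn; case/orP: le_kn => [/eqP->|lt_kn].
  rewrite /qabel /= !qbinomnn [qbinom n.+1 _]qbinom_small //.
  by rewrite [qbinom n _]qbinom_small // !subnn; ring.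
set y := qint (n.+1 + s).
have Dy : y = qint (k + s) + 'X^(k + s) * qint (n.+1 - k).
  by rewrite -qintD /y; congr qint; lia.
have Ek : (n.+1 - k = (n - k).+1)%N by lia.
have L := mul_qbinom_left n.+1 k.
rewrite {1 4}/qabel subSS -/y.
have -> : 'X^(k + s) * qint k.+1 * (qbinom n.+1 k.+1 * y ^+ (n - k))
    = 'X^(k + s) * (qint k.+1 * qbinom n.+1 k.+1) * y ^+ (n - k) by ring.
rewrite {}L.
have -> : y ^+ (n.+1 - k) = y * y ^+ (n - k) by rewrite Ek exprS.
suff E : qbinom n.+1 k * qint (k + s) * y ^+ (n - k)
   = one_oplus (qabel s.+1) n.+1 k
     + 'X^k * qint s * one_oplus (qabel s.+1) n.+1 k.+1.
  by rewrite -E {1}Dy; ring.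
case: k {Dy} lt_kn Ek => [|k] lt_kn Ek /=; rewrite /qabel addnS -addSn -/y.
  by rewrite !qbinom0 add0n expr0; ring.
rewrite qbinom_shift -/y; have -> : (n - k = (n - k.+1).+1)%N by lia.
by rewrite (exprS y); ring.
Qed.

Lemma TP_qabel N s : TP_upto N (qabel s).
Proof.
elim: N s => [|N IHN] s; first exact: TP_upto0.
apply: (TP_bidiagonal_inv (c := fun k => 'X^(k + s) * qint k.+1)).
- by move=> k; apply: nonnegM; [apply: nonnegXn | apply: nonneg_qint].
- by move=> n k lt_nk; rewrite /qabel qbinom_small ?mul0r.
- exact: qabel_rec.
apply: (TP_bidiagonal (b := fun k => 'X^k * qint s)).
  by move=> k; apply: nonnegM; [apply: nonnegXn | apply: nonneg_qint].
exact/TP_one_oplus/IHN.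
Qed.

Lemma qtreesE n k : qtrees n k = qabel 0 n k.
Proof.
rewrite /qtrees /qabel addn0; case: leqP => // lt_nk.
by rewrite qbinom_small ?mul0r.
Qed.

Lemma qforestsE n k : qforests n k = one_oplus (qabel 1) n k.
Proof.
case: k => [|k]; first by case: n.
case: n => [|n] //; rewrite /qforests /= /qabel addn1 subSS ltnS.
by case: leqP => // lt_nk; rewrite qbinom_small ?mul0r.
Qed.

Theorem theorem1p2 :
  coefficientwise_TP qforests /\ coefficientwise_TP qtrees.
Proof.
split; apply: TP_uptoP => N.
  case: N => [|N]; first exact: TP_upto0.
  by apply: eq_TP_upto (TP_one_oplus (@TP_qabel N 1)) => n k _;
    rewrite qforestsE.
by apply: eq_TP_upto (@TP_qabel N 0) => n k _; rewrite qtreesE.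
Qed.
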